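(* Let $R$ be a one-dimensional Noetherian local domain with integral closure $\overline{R}$ (in its fraction field $K$) and conductor $\mathfrak{C}=R:_K\overline{R}$. Assume that the completion $\widehat{R}$ is reduced. If $J$ is any ideal of $R$ with $\mathfrak{C}\subseteq J$, then $h(J)=\lambda(R/J)$. In particular, $h(\mathfrak{C})=\lambda(R/\mathfrak{C})$.
   Context: $\lambda(\cdot)$ denotes length as an $R$-module; $R:_K\overline{R}=\{\alpha\in K\mid \alpha\overline{R}\subseteq R\}$. Invariant $h$: for a finitely generated $R$-module $M$ of non-zero rank over a one-dimensional Noetherian local domain $R$, $h(M):=\min\{\lambda(R/I)\mid I=\phi(M)\text{ for some }R\text{-homomorphism }\phi:M\to R\}$ (the zero map contributes $\infty$). For a non-zero ideal $J$ this is $h(J)=\min\{\lambda(R/I)\mid I\text{ an ideal of }R,\ I\cong J\}$. *)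

(* Defs.v *)
From HB Require Import structures.
From mathcomp Require Import all_boot all_order all_algebra.
From mathcomp Require Import generic_quotient ring_quotient fraction.
From mathcomp Require Import boolp classical_sets functions.

Set Implicit Arguments.
Unset Strict Implicit.
Unset Printing Implicit Defensive.

Import GRing.Theory.
Local Open Scope ring_scope.
Local Open Scope quotient_scope.
Local Open Scope classical_set_scope.

(* Ideals of a commutative ring R (the unit ideal included) are the
   submodules of R^o, i.e. terms of type [submodClosed R^o]; [idealr] from
   ring_quotient only covers proper ideals.  Membership predicates are
   boolean, which is no restriction in the presence of classical logic. *)

(* Natural numbers extended with a top element None, standing for infinity. *)
Definition enat := option nat.

(* The least element of A (if A is not empty); None if A has no finite element. *)
Definition emin (A : set enat) : enat :=
  match pselect (exists n, `[< A (Some n) >]) with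
  | left A_fin => Some (ex_minn A_fin)
  | right _ => None
  end.

Definition esup (A : set nat) : enat :=
  emin [set u | if u is Some n then forall k, A k -> (k <= n)%N else True].

Lemma emin_in (A : set enat) : A !=set0 -> A (emin A).
Proof.
rewrite /emin; case: pselect => [A_fin _|A_inf [[n|//] An]].
  by case: ex_minnP => n /asboolP.
by case: A_inf; exists n; apply/asboolP.
Qed.

Lemma emin_lb (A : set enat) n :
  A (Some n) -> exists2 k, emin A = Some k & (k <= n)%N.
Proof.
rewrite /emin; case: pselect => [A_fin|A_inf] An.
  by eexists; [reflexivity|]; case: ex_minnP => k _; apply; apply/asboolP.
by case: A_inf; exists n; apply/asboolP.
Qed.

Section QuotientModule.
Variables (R : pzRingType) (V : lmodType R) (N : submodClosed V).

(* [submodClosed] records no closure under opposites, which follows from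
   scaling by -1; the library quotient wants it explicitly. *)
Definition submod_zmod : {pred V} := fun x => x \in N.

HB.instance Definition _ := GRing.isZmodClosed.Build V submod_zmod
  (GRing.submod_closedB (submodClosedP N)).

Definition quotmod : Type := Quotient.quot submod_zmod.

HB.instance Definition _ := GRing.Zmodule.on quotmod.
HB.instance Definition _ := EqQuotient.on quotmod.

Lemma quotmodP (x y : V) : \pi_quotmod x = \pi_quotmod y <-> x - y \in N.
Proof.
have -> : (x - y \in N) = (x == y %[mod Quotient.quot submod_zmod]).
  by rewrite -Quotient.idealrBE.
by split=> /eqP.
Qed.

Lemma quotmodD (x y : V) :
  \pi_quotmod (x + y) = \pi_quotmod x + \pi_quotmod y.
Proof. exact: (Quotient.pi_add submod_zmod x y). Qed.

Lemma quotmod_surj (x : quotmod) : exists y : V, \pi_quotmod y = x.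
Proof. by exists (repr x); rewrite reprK. Qed.

Definition quotmod_scale (a : R) (x : quotmod) : quotmod :=
  \pi_quotmod (a *: repr x).

Lemma quotmod_scaleE (a : R) (x : V) :
  quotmod_scale a (\pi_quotmod x) = \pi_quotmod (a *: x).
Proof.
by apply/quotmodP; rewrite -scalerBr rpredZ //; apply/quotmodP; rewrite reprK.
Qed.

Fact quotmod_scaleA a b (x : quotmod) :
  quotmod_scale a (quotmod_scale b x) = quotmod_scale (a * b) x.
Proof. by have [y <-] := quotmod_surj x; rewrite !quotmod_scaleE scalerA. Qed.

Fact quotmod_scale1 : left_id 1 quotmod_scale.
Proof.
by move=> x; have [y <-] := quotmod_surj x; rewrite quotmod_scaleE scale1r.
Qed.

Fact quotmod_scaleDr : right_distributive quotmod_scale +%R.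
Proof.
move=> a x y; have [u <-] := quotmod_surj x; have [v <-] := quotmod_surj y.
by rewrite -quotmodD !quotmod_scaleE scalerDr quotmodD.
Qed.

Fact quotmod_scaleDl (x : quotmod) :
  {morph quotmod_scale^~ x : a b / a + b >-> a + b}.
Proof.
move=> a b; have [y <-] := quotmod_surj x.
by rewrite !quotmod_scaleE scalerDl quotmodD.
Qed.

HB.instance Definition _ := GRing.Zmodule_isLmodule.Build R quotmod
  quotmod_scaleA quotmod_scale1 quotmod_scaleDr quotmod_scaleDl.

End QuotientModule.

Section QuotientRing.
Variables (R : comPzRingType) (I : submodClosed R^o).
Local Notation Q := (quotmod I).

Definition quotmod_one : Q := \pi_Q (1 : R).
Definition quotmod_mul (x y : Q) : Q := \pi_Q ((repr x : R) * repr y).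

Lemma quotmod_mulE (x y : R) :
  quotmod_mul (\pi_Q (x : R^o)) (\pi_Q (y : R^o)) = \pi_Q (x * y : R^o).
Proof.
have reprE (z : R) : (repr (\pi_Q (z : R^o)) : R) - z \in I.
  by apply/(@quotmodP _ _ I); rewrite reprK.
apply/quotmodP; set x' := (repr _ : R); set y' := (repr (\pi_Q y) : R).
have -> : x' * y' - x * y = x' * (y' - y) + y * (x' - x).
  by rewrite !mulrBr (mulrC y) (mulrC y) addrA subrK.
by apply: rpredD; apply: (rpredZ (V := R^o)); apply: reprE.
Qed.

Fact quotmod_mulA : associative quotmod_mul.
Proof.
move=> x y z; have [r <-] := quotmod_surj x; have [s <-] := quotmod_surj y.
by have [t <-] := quotmod_surj z; rewrite !quotmod_mulE mulrA.
Qed.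

Fact quotmod_mulC : commutative quotmod_mul.
Proof.
move=> x y; have [r <-] := quotmod_surj x; have [s <-] := quotmod_surj y.
by rewrite !quotmod_mulE mulrC.
Qed.

Fact quotmod_mul1 : left_id quotmod_one quotmod_mul.
Proof.
by move=> x; have [r <-] := quotmod_surj x; rewrite quotmod_mulE mul1r.
Qed.

Fact quotmod_mulDl : left_distributive quotmod_mul +%R.
Proof.
move=> x y z; have [r <-] := quotmod_surj x; have [s <-] := quotmod_surj y.
have [t <-] := quotmod_surj z.
by rewrite -quotmodD !quotmod_mulE -quotmodD -mulrDl.
Qed.

HB.instance Definition _ := GRing.Zmodule_isComPzRing.Build Q
  quotmod_mulA quotmod_mulC quotmod_mul1 quotmod_mulDl.

End QuotientRing.

Section SubmoduleType.
Variables (R : pzRingType) (V : lmodType R) (N : submodClosed V).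

Definition submodule : Type := {x : V | x \in N}.

HB.instance Definition _ := SubChoice.on submodule.
HB.instance Definition _ := [SubChoice_isSubLmodule of submodule by <:].

End SubmoduleType.

Section LinearImage.
Variables (R : pzRingType) (U V : lmodType R) (phi : {linear U -> V}).

Definition linear_image : {pred V} := fun y => `[< exists x, phi x = y >].

Fact linear_image_submod_closed : submod_closed linear_image.
Proof.
split; first by apply/asboolP; exists 0; rewrite linear0.
move=> a _ _ /asboolP[x <-] /asboolP[y <-].
by apply/asboolP; exists (a *: x + y); rewrite linearP.
Qed.

HB.instance Definition _ :=
  GRing.isSubmodClosed.Build R V linear_image linear_image_submod_closed.

End LinearImage.

Definition strict_chain (R : pzRingType) (V : lmodType R)
    (N : nat -> submodClosed V) (n : nat) : Prop :=
  forall i, (i < n)%N ->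
    {subset N i <= N i.+1} /\ ~ {subset N i.+1 <= N i}.

Definition length (R : pzRingType) (M : lmodType R) : enat :=
  esup [set n | exists N : nat -> submodClosed M, strict_chain N n].

(* Intended for finitely generated M of non-zero rank over a one-dimensional
   noetherian local domain R.  There the zero map has image 0 and R / 0 has
   infinite length, i.e. None, so it needs no separate treatment. *)
Definition h (R : comPzRingType) (M : lmodType R) : enat :=
  emin [set length (quotmod (linear_image phi))
       | phi in [set: {linear M -> R^o}]].

Section Ideals.
Variable R : comNzRingType.

Definition prime_ideal (P : submodClosed R^o) : Prop :=
  (1 : R) \notin P /\ prime_idealr_closed (R := R) P.

Definition maximal_ideal (m : submodClosed R^o) : Prop :=
  (1 : R) \notin m /\
  forall I : submodClosed R^o,
    (1 : R) \notin I -> {subset m <= I} -> {subset I <= m}.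

Definition finitely_generated_ideal (I : submodClosed R^o) : Prop :=
  exists (n : nat) (g : 'I_n -> R),
    forall x : R, x \in I <-> exists c : 'I_n -> R, x = \sum_i c i * g i.

Definition krull_dim : enat :=
  esup [set n | exists P : nat -> submodClosed R^o,
    (forall i, (i <= n)%N -> prime_ideal (P i)) /\ strict_chain P n].

Definition noetherian_ring : Prop :=
  forall I : submodClosed R^o, finitely_generated_ideal I.

Definition local_ring (m : submodClosed R^o) : Prop :=
  maximal_ideal m /\
  forall m' : submodClosed R^o, maximal_ideal m' -> m' =i m.

End Ideals.

Section IdealPower.
Variables (R : comPzRingType) (I : submodClosed R^o).

(* The smallest ideal containing all products of n elements of I; it is the
   unit ideal for n = 0. *)
Definition ideal_pow (n : nat) : {pred R^o} := fun x =>
  `[< forall L : submodClosed R^o,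
        (forall a : 'I_n -> R, (forall j, a j \in I) -> \prod_j a j \in L) ->
        x \in L >].

Fact ideal_pow_submod_closed n : submod_closed (ideal_pow n).
Proof.
split; first by apply/asboolP => L _; rewrite rpred0.
move=> a x y /asboolP Ix /asboolP Iy; apply/asboolP => L LI.
by rewrite rpredD ?rpredZ ?Ix ?Iy.
Qed.

HB.instance Definition _ n :=
  GRing.isSubmodClosed.Build R R^o (ideal_pow n) (ideal_pow_submod_closed n).

End IdealPower.

Section ProductRing.
Variable Q : nat -> comPzRingType.

Definition prodring : Type := forall n, Q n.

HB.instance Definition _ := Choice.copy prodring (forall n, Q n).

Definition prodring_zero : prodring := fun=> 0.
Definition prodring_opp (x : prodring) : prodring := fun n => - x n.
Definition prodring_add (x y : prodring) : prodring := fun n => x n + y n.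
Definition prodring_one : prodring := fun=> 1.
Definition prodring_mul (x y : prodring) : prodring := fun n => x n * y n.

Fact prodring_addA : associative prodring_add.
Proof. by move=> x y z; apply: functional_extensionality_dep => n; apply: addrA. Qed.

Fact prodring_addC : commutative prodring_add.
Proof. by move=> x y; apply: functional_extensionality_dep => n; apply: addrC. Qed.

Fact prodring_add0 : left_id prodring_zero prodring_add.
Proof. by move=> x; apply: functional_extensionality_dep => n; apply: add0r. Qed.

Fact prodring_addN :
  left_inverse prodring_zero prodring_opp prodring_add.
Proof. by move=> x; apply: functional_extensionality_dep => n; apply: addNr. Qed.

HB.instance Definition _ := GRing.isZmodule.Build prodring
  prodring_addA prodring_addC prodring_add0 prodring_addN.

Fact prodring_mulA : associative prodring_mul.
Proof. by move=> x y z; apply: functional_extensionality_dep => n; apply: mulrA. Qed.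

Fact prodring_mulC : commutative prodring_mul.
Proof. by move=> x y; apply: functional_extensionality_dep => n; apply: mulrC. Qed.

Fact prodring_mul1 : left_id prodring_one prodring_mul.
Proof. by move=> x; apply: functional_extensionality_dep => n; apply: mul1r. Qed.

Fact prodring_mulDl : left_distributive prodring_mul +%R.
Proof. by move=> x y z; apply: functional_extensionality_dep => n; apply: mulrDl. Qed.

HB.instance Definition _ := GRing.Zmodule_isComPzRing.Build prodring
  prodring_mulA prodring_mulC prodring_mul1 prodring_mulDl.

End ProductRing.

(* The I-adic completion, as the inverse limit of the rings R / I^n. *)
Section Completion.
Variables (R : comPzRingType) (I : submodClosed R^o).
Local Notation Q n := (quotmod (ideal_pow I n)).

Lemma ideal_powS n : {subset ideal_pow I n.+1 <= ideal_pow I n}.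
Proof.
move=> x /asboolP Ix; apply/asboolP => L LI; apply: Ix => a aI.
rewrite big_ord_recl; apply: (rpredZ (V := R^o)); apply: LI => j.
exact: aI.
Qed.

(* The canonical surjection R / I^(n+1) -> R / I^n. *)
Definition adic_proj n (x : Q n.+1) : Q n := \pi_(Q n) (repr x).

Lemma adic_projE n (x : R) :
  adic_proj (\pi_(Q n.+1) (x : R^o)) = \pi_(Q n) (x : R^o).
Proof.
apply/quotmodP; apply: ideal_powS.
by apply/(@quotmodP _ _ (ideal_pow I n.+1)); rewrite reprK.
Qed.

Lemma adic_projB n : {morph @adic_proj n : x y / x - y}.
Proof.
have piN k (r : R) : \pi_(Q k) (- r : R^o) = - \pi_(Q k) (r : R^o).
  exact: (Quotient.pi_opp (submod_zmod (ideal_pow I k))).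
move=> x y; have [r <-] := quotmod_surj x; have [s <-] := quotmod_surj y.
by rewrite -piN -quotmodD !adic_projE quotmodD piN.
Qed.

Lemma adic_projM n : {morph @adic_proj n : x y / x * y}.
Proof.
have mE k (u v : R) : \pi_(Q k) (u : R^o) * \pi_(Q k) (v : R^o) =
  \pi_(Q k) (u * v : R^o) := quotmod_mulE _ u v.
move=> x y; have [r <-] := quotmod_surj x; have [s <-] := quotmod_surj y.
by rewrite mE !adic_projE mE.
Qed.

Definition adic_compatible : {pred prodring (fun n => Q n)} := fun x =>
  `[< forall n, adic_proj (x n.+1) = x n >].

Fact adic_compatible_subring_closed : subring_closed adic_compatible.
Proof.
split=> [|x y /asboolP Cx /asboolP Cy|x y /asboolP Cx /asboolP Cy];
  apply/asboolP => n; first exact: adic_projE.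
- by apply: etrans (adic_projB _ _) _; rewrite Cx Cy.
- by apply: etrans (adic_projM _ _) _; rewrite Cx Cy.
Qed.

HB.instance Definition _ := GRing.isSubringClosed.Build _ adic_compatible
  adic_compatible_subring_closed.

Definition completion : Type :=
  {x : prodring (fun n => Q n) | x \in adic_compatible}.

HB.instance Definition _ := SubChoice.on completion.
HB.instance Definition _ :=
  GRing.SubChoice_isSubComPzRing.Build _ _ completion
    adic_compatible_subring_closed.

End Completion.

Definition reduced (A : pzRingType) : Prop :=
  forall (x : A) (n : nat), x ^+ n = 0 -> x = 0.

Section Conductor.
Variable R : idomainType.
Local Notation K := {fraction R}.
Local Notation "x %:F" := (@tofrac R x).

(* R :_K Rbar, as a subset of the fraction field K. *)
Definition conductorK : set K :=
  [set a | forall z : K, integralOver (@tofrac R) z ->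
             exists r : R, a * z = r%:F].

(* The same set viewed as an ideal of R: see conductorE. *)
Definition conductor : {pred R^o} := fun r => `[< conductorK (r : R)%:F >].

Lemma conductorE (a : K) :
  conductorK a <-> exists2 r : R, r \in conductor & a = r%:F.
Proof.
split=> [Ca|[r /asboolP Cr ->] //].
have [|r ar] := Ca 1; first exact: integral1.
rewrite mulr1 in ar; exists r => //.
by apply/asboolP; rewrite -ar.
Qed.

Fact conductor_submod_closed : submod_closed conductor.
Proof.
split; first by apply/asboolP => z _; exists 0; rewrite rmorph0 mul0r.
move=> a x y /asboolP Cx /asboolP Cy; apply/asboolP => z Rz.
have [r xz] := Cx z Rz; have [s yz] := Cy z Rz; exists (a * r + s).
by rewrite !rmorphD !rmorphM mulrDl -mulrA xz yz.
Qed.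

HB.instance Definition _ :=
  GRing.isSubmodClosed.Build R R^o conductor conductor_submod_closed.

End Conductor.
Arguments conductor : clear implicits.

(* Main.v *)
Require Import Defs.
From mathcomp Require Import all_boot all_order all_algebra.
From HB Require Import structures.
From mathcomp Require Import generic_quotient fraction.
From mathcomp Require Import boolp classical_sets ring.

(** Write C for the conductor, Rbar for the integral closure, l for length.

    The length count.  A non-zero homomorphism phi : J -> R is multiplication
    by a fraction alpha.  Since C is an Rbar-module, alpha C is an Rbar-module
    contained in R, hence alpha C is contained in C.  Computing the length of
    R / alpha C along two filtrations gives
      l(R / alpha J) + l(alpha J / alpha C)
        = l(R / J) + l(J / C) + l(C / alpha C),
    and multiplication by alpha makes alpha J / alpha C isomorphic to J / C.
    If C is not zero then J / C has finite length because R has dimension one,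
    so it cancels and l(R / alpha J) >= l(R / J); the inclusion of J attains
    equality.  This is [frac_mul_colength], used in
    [conductor_image_colength].  Lengths are handled through the relation
    [seg A B n], saying that a strict chain of n steps leads from A to B.

    The conductor is not zero.  This is where the completion enters, and where
    the statement would fail if it were not reduced.  Fix a non-zero x in the
    maximal ideal.

    - Degrees of integral elements are bounded.  For z in Rbar the finite
      R-module R[z] has rank one, so R[z] / x R[z] is no longer than R / xR,
      say of length at most N.  So the images of 1, z, z^2, ... span it after
      N steps; as some power of x maps R[z] into R, iterating shows that
      1, ..., z^(N-1) generate R[z].  The bound N does not depend on z.  If
      x^k z = s lies in R, clearing denominators in the resulting equation of
      degree N gives that x^k divides s^N ([integral_exp_dvd]).

    - Let T_n be the ideal of the elements of R lying in x^n Rbar.  Suppose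
      that no T_n is contained in xR.  As R / x^k R has finite length,
      the images of the T_n in it stabilize, and a compactness argument
      gives s_k in T_k, outside xR, with s_(k+1) congruent to s_k modulo
      x^(k+1).  The limit of the s_k in the completion is not zero, but its
      N-th power is, since x^k divides s_k^N: the completion is not reduced.

    - So some T_n is contained in xR ([closure_power_sub_principal]).  For z
      in Rbar take the least k with x^k z in R.  If k > n, then x^k z
      belongs to T_n, hence to xR, and x^(k-1) z is in R: a contradiction.  So
      x^n Rbar is contained in R, that is x^n lies in C. *)

Set Implicit Arguments.
Unset Strict Implicit.
Unset Printing Implicit Defensive.

Import GRing.Theory.
Local Open Scope ring_scope.
Local Open Scope quotient_scope.
Local Open Scope classical_set_scope.

(** * Submodules given by propositions *)

Section SubmodOpp.
Variables (R : pzRingType) (V : lmodType R) (A : submodClosed V).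

Lemma submodN x : x \in A -> - x \in A.
Proof. by move=> Ax; rewrite -scaleN1r rpredZ. Qed.

Lemma submodB x y : x \in A -> y \in A -> x - y \in A.
Proof. by move=> Ax Ay; rewrite rpredD ?submodN. Qed.

End SubmodOpp.

Section PropSubmodule.
Variables (R : pzRingType) (V : lmodType R).

Definition submod_prop (P : V -> Prop) : Prop :=
  P 0 /\ forall a x y, P x -> P y -> P (a *: x + y).

Definition submod_of (P : V -> Prop) (HP : submod_prop P) : {pred V} :=
  fun x => `[< P x >].

Fact submod_of_closed P (HP : submod_prop P) : submod_closed (submod_of HP).
Proof.
case: (HP) => P0 PD; split; first exact/asboolP.
by move=> a x y /asboolP Px /asboolP Py; apply/asboolP; apply: PD.
Qed.

HB.instance Definition _ P (HP : submod_prop P) :=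
  GRing.isSubmodClosed.Build R V (submod_of HP) (submod_of_closed HP).

Lemma submod_ofP P (HP : submod_prop P) x : reflect (P x) (x \in submod_of HP).
Proof. exact: asboolP. Qed.

Lemma zero_submod_prop : submod_prop (fun v => v = 0).
Proof. by split=> // a x y -> ->; rewrite scaler0 addr0. Qed.

Lemma full_submod_prop : submod_prop (fun=> True).
Proof. by []. Qed.

Lemma cap_submod_prop (A B : submodClosed V) :
  submod_prop (fun v => v \in A /\ v \in B).
Proof.
split; first by rewrite !rpred0.
by move=> a x y [Ax Bx] [Ay By]; rewrite !rpredD ?rpredZ.
Qed.

Lemma sum_submod_prop (A B : submodClosed V) :
  submod_prop (fun v => exists u w, [/\ u \in A, w \in B & v = u + w]).
Proof.
split; first by exists 0, 0; rewrite !rpred0 addr0.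
move=> a _ _ [u [w [Au Bw ->]]] [u' [w' [Au' Bw' ->]]].
exists (a *: u + u'), (a *: w + w'); rewrite !rpredD ?rpredZ //; split=> //.
by rewrite scalerDr addrACA.
Qed.

Definition zero_submod : submodClosed V := submod_of zero_submod_prop.
Definition full_submod : submodClosed V := submod_of full_submod_prop.
Definition cap_submod A B : submodClosed V := submod_of (cap_submod_prop A B).
Definition sum_submod A B : submodClosed V := submod_of (sum_submod_prop A B).

Lemma in_full v : v \in full_submod. Proof. exact/submod_ofP. Qed.

Lemma sub_full (A : submodClosed V) : {subset A <= full_submod}.
Proof. by move=> x _; apply: in_full. Qed.

Lemma zero_sub (A : submodClosed V) : {subset zero_submod <= A}.
Proof. by move=> x /submod_ofP ->; rewrite rpred0. Qed.

Lemma sub_suml (A B : submodClosed V) : {subset A <= sum_submod A B}.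
Proof. by move=> x Ax; apply/submod_ofP; exists x, 0; rewrite rpred0 addr0. Qed.

Lemma sub_sumr (A B : submodClosed V) : {subset B <= sum_submod A B}.
Proof. by move=> x Bx; apply/submod_ofP; exists 0, x; rewrite rpred0 add0r. Qed.

Lemma sum_sub (A B C : submodClosed V) :
  {subset A <= C} -> {subset B <= C} -> {subset sum_submod A B <= C}.
Proof.
move=> leAC leBC x /submod_ofP[u [w [Au Bw ->]]].
by apply: rpredD; [apply: leAC | apply: leBC].
Qed.

End PropSubmodule.

(** * Chains between two submodules *)

Section Segments.
Variables (R : pzRingType) (V : lmodType R).
Implicit Types A B C D : submodClosed V.

(** The length of B / A is the largest n with [seg A B n].  Speaking of chains
    in the ambient module avoids forming subquotients, and the inductive
    form replaces the bookkeeping of indices by induction on the last step. *)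
Inductive seg A : submodClosed V -> nat -> Prop :=
| seg_nil B : {subset A <= B} -> seg A B 0
| seg_step B C n : seg A B n -> {subset B <= C} -> ~ {subset C <= B} ->
    seg A C n.+1.

Lemma seg_sub A B n : seg A B n -> {subset A <= B}.
Proof. by elim=> // {}B C {}n _ AB BC _ x /AB/BC. Qed.

Lemma seg_widenr A B B' n : seg A B n -> {subset B <= B'} -> seg A B' n.
Proof.
case=> [{}B AB|{}B C {}n AB BC CB] BB'; first by apply: seg_nil => x /AB/BB'.
by apply: seg_step AB _ _ => [x /BC/BB'|B'B] //; apply: CB => x /BB'/B'B.
Qed.

Lemma seg_widenl A A' B n : seg A B n -> {subset A' <= A} -> seg A' B n.
Proof.
move=> AB A'A; elim: AB => [{}B AB|{}B C {}n _ A'B BC CB].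
  by apply: seg_nil => x /A'A/AB.
exact: seg_step A'B BC CB.
Qed.

Lemma seg_trunc A B n k : seg A B n -> (k <= n)%N -> seg A B k.
Proof.
elim=> [{}B AB|{}B C {}n AB IH BC CB].
  by rewrite leqn0 => /eqP->; apply: seg_nil.
rewrite leq_eqVlt => /predU1P[->|]; first exact: seg_step AB BC CB.
by rewrite ltnS => /IH /seg_widenr; apply.
Qed.

Lemma seg_cat A B C a b : seg A B a -> seg B C b -> seg A C (a + b).
Proof.
move=> AB; elim=> [{}C BC|D {}C {}b _ AD DC CD].
  by rewrite addn0; apply: seg_widenr BC.
by rewrite addnS; apply: seg_step AD DC CD.
Qed.

(** The modular law: a strict step D < C of a chain stays strict after
    intersecting with B or after adding B.  Together with [seg_cat] this is
    the additivity of length. *)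
Lemma seg_split A B C n : seg A C n -> {subset A <= B} ->
  exists a b, [/\ (n <= a + b)%N, seg A (cap_submod C B) a
                & seg B (sum_submod C B) b].
Proof.
move=> leAC AB; elim: leAC => [{}C leAC|D {}C {}n AD [a [b [nab sA sB]]] DC CD].
  exists 0%N, 0%N; split=> //; apply: seg_nil; last exact: sub_sumr.
  by move=> x Ax; apply/submod_ofP; split; [apply: leAC | apply: AB].
have capS : {subset cap_submod D B <= cap_submod C B}.
  by move=> x /submod_ofP[/DC Cx Bx]; apply/submod_ofP.
have sumS : {subset sum_submod D B <= sum_submod C B}.
  apply: sum_sub; last exact: sub_sumr.
  by move=> x /DC; apply: sub_suml.
have [CDcap|CDcap] := pselect {subset cap_submod C B <= cap_submod D B}.
  exists a, b.+1; split; first by rewrite addnS ltnS.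
    exact: seg_widenr sA capS.
  apply: seg_step sB sumS _ => CDsum; apply: CD => x Cx.
  have /CDsum/submod_ofP[u [w [Du Bw xE]]] := sub_suml B Cx.
  have Cw : w \in C by rewrite -[w](addKr u) -xE; apply: rpredD => //; apply/submodN/DC.
  have /submod_ofP[Dw _] : w \in cap_submod D B.
    by apply: CDcap; apply/submod_ofP.
  by rewrite xE rpredD.
exists a.+1, b; split; first by rewrite addSn ltnS.
  exact: seg_step sA capS CDcap.
exact: seg_widenr sB sumS.
Qed.

Lemma seg_split_at A B C n : seg A C n -> {subset A <= B} -> {subset B <= C} ->
  exists a b, [/\ (n <= a + b)%N, seg A B a & seg B C b].
Proof.
move=> leAC AB BC; have [a [b [nab sA sB]]] := seg_split leAC AB.
exists a, b; split=> //; first by apply: seg_widenr sA _ => x /submod_ofP[].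
by apply: seg_widenr sB _; apply: sum_sub.
Qed.

Definition finite_seg A B := exists N, forall n, seg A B n -> (n <= N)%N.

Lemma finite_seg_max A B : {subset A <= B} -> finite_seg A B ->
  exists2 p, seg A B p & forall n, seg A B n -> (n <= p)%N.
Proof.
move=> AB [N Nmax].
have ex0 : exists n, `[< seg A B n >].
  by exists 0%N; apply/asboolP; apply: seg_nil.
have bnd n : `[< seg A B n >] -> (n <= N)%N by move/asboolP/Nmax.
case: (ex_maxnP ex0 bnd) => p /asboolP ABp pmax.
by exists p => // n ABn; apply/pmax/asboolP.
Qed.

Lemma finite_segS A A' B B' : {subset A <= A'} -> {subset B' <= B} ->
  finite_seg A B -> finite_seg A' B'.
Proof.
move=> AA' BB' [N Nmax]; exists N => n A'B'n; apply: Nmax.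
exact: seg_widenl (seg_widenr A'B'n BB') AA'.
Qed.

Lemma finite_seg_cat A B C : {subset A <= B} -> {subset B <= C} ->
  finite_seg A B -> finite_seg B C -> finite_seg A C.
Proof.
move=> AB BC [N Nmax] [M Mmax]; exists (N + M)%N => n ACn.
have [a [b [nab sA sB]]] := seg_split_at ACn AB BC.
by rewrite (leq_trans nab) // leq_add ?Nmax ?Mmax.
Qed.

(** A submodule D n0 whose chains up to B are as long as possible cannot
    contain another D n strictly. *)
Lemma finite_seg_dcc A B (D : nat -> submodClosed V) : finite_seg A B ->
  (forall n, {subset A <= D n} /\ {subset D n <= B}) ->
  (forall n k, (n <= k)%N -> {subset D k <= D n}) ->
  exists n0, forall n, {subset D n0 <= D n}.
Proof.
move=> [N Nmax] AD Ddec.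
have ex0 : exists p, `[< exists n, seg (D n) B p >].
  by exists 0%N; apply/asboolP; exists 0%N; apply: seg_nil; have [] := AD 0%N.
have bnd p : `[< exists n, seg (D n) B p >] -> (p <= N)%N.
  by move=> /asboolP[n DBn]; apply/Nmax/(seg_widenl DBn); have [] := AD n.
case: (ex_maxnP ex0 bnd) => p /asboolP[n0 DBp] pmax.
exists n0 => n; apply: contrapT => nD.
have [nn0|/ltnW n0n] := leqP n n0; first by apply: nD; apply: Ddec.
suff /pmax : `[< exists n, seg (D n) B (1 + p) >] by rewrite ltnn.
apply/asboolP; exists n; apply: seg_cat DBp.
by apply: seg_step (Ddec _ _ n0n) nD; apply: seg_nil.
Qed.

End Segments.

(** The device for comparing lengths: every transport of chains below (through
    a quotient, a colon ideal or a multiplication) is an instance. *)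
Lemma seg_map (R : pzRingType) (V W : lmodType R)
    (g : submodClosed V -> submodClosed W) (A B : submodClosed V) n :
  seg A B n ->
  (forall D D' : submodClosed V, {subset A <= D} -> {subset D <= D'} -> {subset D' <= B} ->
     {subset g D <= g D'} /\ ({subset g D' <= g D} -> {subset D' <= D})) ->
  seg (g A) (g B) n.
Proof.
elim=> [{}B AB|{}B C {}n AB IH BC CB] gP.
  by apply: seg_nil; have [] := gP A B.
have [//|gBC gCB] := gP B C (seg_sub AB) BC.
apply: seg_step gBC _ => [|/gCB//].
by apply: IH => D D' AD DD' D'B; apply: gP => // x /D'B/BC.
Qed.

(** * Length of a quotient *)

Lemma strict_chainP (R : pzRingType) (V : lmodType R) n :
  (exists N : nat -> submodClosed V, strict_chain N n) <->
  seg (zero_submod V) (full_submod V) n.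
Proof.
split=> [[N Nn]|].
  suff s k : (k <= n)%N -> seg (N 0%N) (N k) k.
    have sn := seg_widenr (s n (leqnn n)) (@sub_full _ _ (N n)).
    exact: seg_widenl sn (@zero_sub _ _ (N 0%N)).
  elim: k => [_|k IH kn]; first exact: seg_nil.
  have [NS SN] := Nn _ kn.
  exact: seg_step (IH (ltnW kn)) NS SN.
suff s A B : seg A B n ->
    exists2 N : nat -> submodClosed V, strict_chain N n & N n = B.
  by move=> /s[N Nn _]; exists N.
elim=> [{}B _|{}B C {}n _ [N Nn NB] BC CB]; first by exists (fun=> B).
exists (fun i => if (i <= n)%N then N i else C); last by rewrite ltnn.
move=> i; rewrite ltnS leq_eqVlt => /predU1P[->|ilt].
  by rewrite eqxx ltnn NB.
by rewrite ilt orbT; apply: Nn.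
Qed.

Lemma preim_submod_prop (R : pzRingType) (V W : lmodType R)
  (f : V -> W) (fL : linear f) (D : submodClosed W) :
  submod_prop (fun v => f v \in D).
Proof.
split; last by move=> a x y Dx Dy; rewrite fL rpredD ?rpredZ.
have -> : f 0 = 0; last exact: rpred0.
have := fL (-1) 0 0; rewrite scaler0 addr0 scaleN1r addNr //.
Qed.

Lemma im_submod_prop (R : pzRingType) (V W : lmodType R)
  (f : V -> W) (fL : linear f) (D : submodClosed V) :
  submod_prop (fun w => exists2 v, v \in D & f v = w).
Proof.
split.
  exists 0; first exact: rpred0.
  have := fL (-1) 0 0; rewrite scaler0 addr0 scaleN1r addNr //.
move=> a _ _ [v Dv <-] [w Dw <-]; exists (a *: v + w); last exact: fL.
by rewrite rpredD ?rpredZ.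
Qed.

Lemma quotmod_pi_linear (R : pzRingType) (V : lmodType R) (J : submodClosed V) :
  linear (fun v : V => \pi_(quotmod J) v).
Proof. by move=> a x y; rewrite quotmodD -[in LHS]quotmod_scaleE. Qed.

Lemma quotmod_pi_eq0 (R : pzRingType) (V : lmodType R) (J : submodClosed V)
    (v : V) :
  \pi_(quotmod J) v = 0 <-> v \in J.
Proof.
have pi0 : \pi_(quotmod J) (0 : V) = 0.
  by apply: (addIr (\pi_(quotmod J) 0)); rewrite -quotmodD !add0r.
by rewrite -pi0; apply: iff_trans (quotmodP _ _ _) _; rewrite subr0.
Qed.

Lemma quotmod_seg (R : pzRingType) (V : lmodType R) (J : submodClosed V) n :
  seg (zero_submod (quotmod J)) (full_submod (quotmod J)) n <->
  seg J (full_submod V) n.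
Proof.
pose pre D : submodClosed V := submod_of (preim_submod_prop (@quotmod_pi_linear _ _ J) D).
pose im D : submodClosed (quotmod J) := submod_of (im_submod_prop (@quotmod_pi_linear _ _ J) D).
split=> s.
  have sP : seg (pre (zero_submod _)) (pre (full_submod _)) n.
    apply: seg_map s _ => D D' _ DD' _.
    split=> [x /submod_ofP /DD' D'x|D'D q]; first exact/submod_ofP.
    have [v <-] := quotmod_surj q => D'v.
    by have /D'D/submod_ofP : v \in pre D' by apply/submod_ofP.
  apply: seg_widenl (seg_widenr sP (@sub_full _ _ _)) _ => x Jx.
  by apply/submod_ofP/submod_ofP/quotmod_pi_eq0.
have sI : seg (im J) (im (full_submod V)) n.
  apply: seg_map s _ => D D' JD DD' _; split.
    by move=> _ /submod_ofP[v /DD' D'v <-]; apply/submod_ofP; exists v.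
  move=> D'D x D'x.
  have /D'D/submod_ofP[v Dv /quotmodP vx] : \pi_(quotmod J) x \in im D'.
    by apply/submod_ofP; exists x.
  by rewrite -[x](subKr v); apply: submodB => //; apply: JD.
apply: seg_widenl (seg_widenr sI (@sub_full _ _ _)) (@zero_sub _ _ _).
Qed.

Lemma length_quotmod (R : pzRingType) (V : lmodType R) (J : submodClosed V) :
  length (quotmod J) = esup (fun n => seg J (full_submod V) n).
Proof.
rewrite /length; congr esup; apply/funext => n; apply/propext.
exact: iff_trans (strict_chainP _ n) (quotmod_seg J n).
Qed.

(** * Minima and suprema in the extended naturals *)

Lemma esup_ub (A : set nat) n k : esup A = Some n -> A k -> (k <= n)%N.
Proof.
move=> An; set U := [set u | if u is Some n then forall k, A k -> (k <= n)%N
                            else True].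
have : U (emin U) by apply: emin_in; exists None.
by rewrite -[emin U]/(esup A) An; apply.
Qed.

Lemma esup_attained (A : set nat) n :
  esup A = Some n.+1 -> exists2 k, A k & (n < k)%N.
Proof.
move=> An; apply: contrapT => noA.
have ub k : A k -> (k <= n)%N.
  by move=> Ak; rewrite leqNgt; apply/negP => nk; apply: noA; exists k.
have [k] := emin_lb (A := [set u | if u is Some n then
  forall k, A k -> (k <= n)%N else True]) ub.
by rewrite -/(esup A) An => -[<-]; rewrite ltnn.
Qed.

Lemma esup_mono (A B : set nat) n : A `<=` B -> esup B = Some n ->
  exists2 k, esup A = Some k & (k <= n)%N.
Proof. by move=> AB Bn; apply: emin_lb => k /AB; apply: esup_ub. Qed.

Lemma emin_eq (S : set enat) l : S l ->
  (forall n, S (Some n) -> exists2 k, l = Some k & (k <= n)%N) -> emin S = l.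
Proof.
move=> Sl lmin; have : S (emin S) by apply: emin_in; exists l.
case: l => [k|] in Sl lmin *.
  have [j -> jk] := emin_lb Sl.
  by move=> /lmin[_ [<-] kj]; congr Some; apply/eqP; rewrite eqn_leq jk.
by case: (emin S) => // n /lmin[].
Qed.

(** * Ideals *)

Section IdealConstructions.
Variable R : comNzRingType.
Implicit Types I J : submodClosed R^o.

Lemma ideal0 I : (0 : R) \in I.
Proof. exact: (rpred0 I). Qed.

Lemma idealD I (x y : R) : x \in I -> y \in I -> x + y \in I.
Proof. exact: (@rpredD _ I). Qed.

Lemma idealB I (x y : R) : x \in I -> y \in I -> x - y \in I.
Proof. exact: (@submodB _ _ I). Qed.

Lemma idealMl I (a x : R) : x \in I -> a * x \in I.
Proof. by move=> Ix; apply: (rpredZ (V := R^o)). Qed.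

Lemma idealMr I (a x : R) : x \in I -> x * a \in I.
Proof. by rewrite mulrC; apply: idealMl. Qed.

Lemma ideal1 I (x : R) : 1 \in I -> x \in I.
Proof. by rewrite -[x]mulr1; apply: idealMl. Qed.

Lemma colon_submod_prop I (a : R) :
  submod_prop (V := R^o) (fun r => (a * r : R) \in I).
Proof.
split; first by rewrite mulr0 ideal0.
move=> c x y Ix Iy; rewrite [_ *: _]/(c * x) mulrDr mulrCA.
by rewrite idealD // idealMl.
Qed.

Lemma principal_submod_prop (a : R) :
  submod_prop (V := R^o) (fun r => exists c : R, r = a * c).
Proof.
split; first by exists 0; rewrite mulr0.
by move=> c _ _ [u ->] [v ->]; exists (c * u + v); rewrite mulrDr mulrCA.
Qed.

Definition colon I a : submodClosed R^o := submod_of (colon_submod_prop I a).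
Definition principal a : submodClosed R^o :=
  submod_of (principal_submod_prop a).

Lemma principalP (a r : R) : reflect (exists c, r = a * c) (r \in principal a).
Proof. exact: (submod_ofP (principal_submod_prop a)). Qed.

Lemma colonP I (a r : R) : reflect (a * r \in I) (r \in colon I a).
Proof. exact: (submod_ofP (colon_submod_prop I a)). Qed.

Lemma in_zero_submod (r : R) : (r \in zero_submod R^o) = (r == 0).
Proof. by apply/(submod_ofP (zero_submod_prop R^o))/eqP. Qed.

Lemma sum_principalP I (a r : R) :
  r \in sum_submod I (principal a) -> exists i c : R, i \in I /\ r = i + a * c.
Proof. move=> /(submod_ofP (sum_submod_prop I (principal a))).
by move=> [i [_ [Ii /principalP[c ->] ->]]]; exists i, c. Qed.

Lemma sub_principal I a : a \in I -> {subset principal a <= I}.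
Proof. by move=> Ia _ /principalP[c ->]; apply: idealMr. Qed.

Lemma mem_principal a : a \in principal a.
Proof. by apply/principalP; exists 1; rewrite mulr1. Qed.

Lemma principal_expS (x : R) i j : (i <= j)%N ->
  {subset principal (x ^+ j) <= principal (x ^+ i)}.
Proof.
move=> ij; apply: sub_principal; apply/principalP.
by exists (x ^+ (j - i)); rewrite -exprD subnKC.
Qed.

Lemma sub_colon I a : {subset I <= colon I a}.
Proof. by move=> r Ir; apply/colonP/idealMl. Qed.

(** Multiplication by a identifies R / (I : a) with (I + aR) / I. *)
Lemma finite_seg_colon I a :
  finite_seg (sum_submod I (principal a)) (full_submod R^o) ->
  finite_seg (colon I a) (full_submod R^o) ->
  finite_seg I (full_submod R^o).
Proof.
move=> fs [N Nmax].
apply: finite_seg_cat (@sub_suml _ _ _ _) (@sub_full _ _ _) _ fs.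
exists N => n s; apply: Nmax.
apply: (seg_widenr _ (@sub_full _ _ (colon (sum_submod I (principal a)) a))).
apply: (seg_map (g := fun D => colon D a) s).
move=> D D' ID DD' D'sum; split=> [r /colonP Dr|D'D d' D'd'].
  by apply/colonP/DD'.
have [i [r [Ii d'E]]] := sum_principalP (D'sum _ D'd').
have D'ar : a * r \in D'.
  by rewrite -[a * r](addKr i) -d'E addrC idealB //; apply: DD' => //; apply: ID.
have /D'D/colonP Dar : r \in colon D' a by apply/colonP.
by rewrite d'E idealD //; apply: ID.
Qed.

End IdealConstructions.

(** * Multiplication by a fraction *)

Section FractionMultiple.
Variable R : idomainType.
Implicit Types C D I J : submodClosed R^o.

Lemma frac_mul_submod_prop (a b : R) I :
  submod_prop (V := R^o) (fun v => exists2 u : R, u \in I & b * v = a * u).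
Proof.
split; first by exists 0; rewrite ?ideal0 // !mulr0.
move=> c v v' [u Iu vu] [u' Iu' vu']; exists (c * u + u').
  by rewrite idealD // idealMl.
by rewrite !mulrDr vu' [_ * (c *: v)]mulrCA vu mulrCA.
Qed.

(** The ideal of the elements of R of the form (a / b) u with u in I.  It is
    (a / b) I when that is contained in R, the only case in which it is used;
    staying inside R keeps all chains among ideals. *)
Definition frac_mul a b I : submodClosed R^o :=
  submod_of (frac_mul_submod_prop a b I).

Lemma frac_mulP a b I (v : R) :
  reflect (exists2 u : R, u \in I & b * v = a * u) (v \in frac_mul a b I).
Proof. exact: (submod_ofP (frac_mul_submod_prop a b I)). Qed.

(** Multiplication by b / a carries chains back. *)
Lemma frac_mul_seg (a b : R) C J n : a != 0 -> b != 0 ->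
  {subset C <= J} ->
  (forall u, u \in J -> exists v, b * v = a * u) ->
  seg (frac_mul a b C) (frac_mul a b J) n -> seg C J n.
Proof.
move=> a0 b0 CJ Jab s.
have {}s : seg (frac_mul b a (frac_mul a b C)) (frac_mul b a (frac_mul a b J)) n.
  apply: seg_map s _ => D D' CD DD' D'J; split.
    move=> u /frac_mulP[v /DD' D'v uv].
    by apply/frac_mulP; exists v.
  move=> D'D v D'v; have /frac_mulP[u Ju vu] := D'J v D'v.
  have /D'D/frac_mulP[w Dw uw] : u \in frac_mul b a D'.
    by apply/frac_mulP; exists v.
  suff -> : v = w by [].
  by apply: (mulfI b0); rewrite vu.
apply: seg_widenl (seg_widenr s _) _ => [u /frac_mulP[v /frac_mulP[w Jw vw] uv]|u Cu].
  suff -> : u = w by [].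
  by apply: (mulfI a0); rewrite uv.
have [v vu] := Jab u (CJ u Cu).
by apply/frac_mulP; exists v => //; apply/frac_mulP; exists u.
Qed.

(** The central length count.  With alpha = a / b and q the length of J / C,
    chains from alpha C to C to J to R have p + q + n steps in total; at most
    q of them survive between alpha C and alpha J, because alpha J / alpha C
    is isomorphic to J / C, and the others lie above alpha J.  It is used both
    for the conductor (p = 0) and, with alpha an element x, C an ideal I and
    J = R, to bound the length of I / xI by that of R / xR. *)
Lemma frac_mul_colength (a b : R) C J p n : a != 0 -> b != 0 ->
  {subset C <= J} ->
  (forall u, u \in J -> exists v, b * v = a * u) ->
  finite_seg C J ->
  seg (frac_mul a b C) C p -> seg J (full_submod R^o) n ->
  seg (frac_mul a b J) (full_submod R^o) (p + n).
Proof.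
move=> a0 b0 CJ Jab CJfin sp sn; have [q sq qmax] := finite_seg_max CJ CJfin.
have st := seg_cat (seg_cat sp sq) sn.
have fCJ : {subset frac_mul a b C <= frac_mul a b J}.
  by move=> v /frac_mulP[u /CJ Ju vu]; apply/frac_mulP; exists u.
have [c [d [cd sc sd]]] := seg_split_at st fCJ (@sub_full _ _ _).
have cq : (c <= q)%N by apply: qmax; apply: frac_mul_seg sc.
apply: seg_trunc sd _; rewrite -(leq_add2l q).
by rewrite addnCA addnA (leq_trans cd) // leq_add2r.
Qed.

End FractionMultiple.

Lemma exp_ideal_pow (R : comPzRingType) (I : submodClosed R^o) (x : R) k :
  x \in I -> x ^+ k \in ideal_pow I k.
Proof.
move=> Ix; apply/asboolP => L LI.
by have := LI _ (fun=> Ix); rewrite prodr_const card_ord.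
Qed.

(** * Noetherian domains of dimension one *)

Section NoetherianInduction.
Variable R : comNzRingType.
Hypothesis R_noetherian : noetherian_ring R.

(** A counterexample would start a strictly increasing sequence of ideals; the
    generators of its union all lie in one of its terms. *)
Lemma noetherian_ind (P : submodClosed R^o -> Prop) :
  (forall I : submodClosed R^o,
     (forall J : submodClosed R^o, {subset I <= J} -> ~ {subset J <= I} -> P J) ->
     P I) ->
  forall I, P I.
Proof.
move=> Pind I0; apply: contrapT => nPI0.
have step (I : {I | ~ P I}) : exists J : {I | ~ P I},
    {subset sval I <= sval J} /\ ~ {subset sval J <= sval I}.
  case: I => I nPI /=; apply: contrapT => noJ; apply: nPI; apply: Pind => J IJ JI.
  by apply: contrapT => nPJ; apply: noJ; exists (exist _ J nPJ).
have [F FP] := choice step.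
pose s n := sval (iter n F (exist _ I0 nPI0)).
have sS n : {subset s n <= s n.+1} by have [] := FP (iter n F (exist _ I0 nPI0)).
have nSs n : ~ {subset s n.+1 <= s n}.
  by have [] := FP (iter n F (exist _ I0 nPI0)).
have sle i j : (i <= j)%N -> {subset s i <= s j}.
  move=> /subnKC <-; elim: (j - i)%N => [|d IHd]; first by rewrite addn0.
  by rewrite addnS => x /IHd/sS.
have Uprop : submod_prop (V := R^o) (fun v => exists n, v \in s n).
  split; first by exists 0%N; rewrite ideal0.
  move=> a x y [i xi] [j yj]; exists (maxn i j); apply: idealD.
    by apply: idealMl; apply: sle xi; apply: leq_maxl.
  by apply: sle yj; apply: leq_maxr.
have [r [g gP]] := R_noetherian (submod_of Uprop).
have gs (i : 'I_r) : exists n, g i \in s n.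
  suff /(submod_ofP Uprop) : g i \in submod_of Uprop by [].
  apply/gP; exists (fun j => (j == i)%:R).
  rewrite (bigD1 i) //= eqxx mul1r big1 ?addr0 // => j /negPf->.
  by rewrite mul0r.
have [k kP] := choice gs.
pose M := \max_i k i.
apply: (nSs M) => x sx.
have /gP[c ->] : x \in submod_of Uprop by apply/(submod_ofP Uprop); exists M.+1.
apply: rpred_sum => i _; apply: idealMl; apply: sle (kP i).
exact: leq_bigmax.
Qed.

End NoetherianInduction.

Section DimensionOne.
Variables (R : idomainType) (m : submodClosed R^o).
Hypothesis R_noetherian : noetherian_ring R.
Hypothesis R_local : local_ring m.
Hypothesis R_dim1 : krull_dim R = Some 1%N.
Implicit Types I J P : submodClosed R^o.

Lemma proper_sub_max I : (1 : R) \notin I -> {subset I <= m}.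
Proof.
elim/(noetherian_ind R_noetherian): I => I IH I1.
have [maxI|nmaxI] := pselect (maximal_ideal I).
  by move=> x; rewrite (R_local.2 _ maxI).
have [J [J1 IJ JI]] : exists J, [/\ (1 : R) \notin J, {subset I <= J} &
    ~ {subset J <= I}].
  apply: contrapT => noJ; apply: nmaxI; split=> // J J1 IJ.
  by apply: contrapT => JI; apply: noJ; exists J.
by move=> x /IJ; apply: IH.
Qed.

Lemma max_prime : prime_ideal m.
Proof.
have [[m1 mmax] _] := R_local; split=> // a b mab.
apply/orP; have [ma|nma] := boolP (a \in m); [by left | right].
have : (1 : R) \in sum_submod m (principal a).
  apply: contraNT nma => s1; apply: (mmax _ s1); first exact: sub_suml.
  by apply: sub_sumr; apply: mem_principal.
move=> /sum_principalP[u [c [mu E]]].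
rewrite -[b]mul1r E mulrDl idealD //; first exact: idealMr.
by rewrite mulrAC; apply: idealMr.
Qed.

Lemma zero_prime : prime_ideal (zero_submod R^o).
Proof.
split; first by rewrite in_zero_submod oner_neq0.
by move=> a b; rewrite !in_zero_submod mulf_eq0.
Qed.

(** Otherwise 0 < P < m would be a chain of length two. *)
Lemma nonzero_prime_max P x :
  prime_ideal P -> x \in P -> x != 0 -> {subset m <= P}.
Proof.
move=> Pprime Px x0; apply: contrapT => mP.
pose chain n := if n is n'.+1 then if n' is 0 then P else m else zero_submod R^o.
suff ch : exists Q : nat -> submodClosed R^o,
    (forall i, (i <= 2)%N -> prime_ideal (Q i)) /\ strict_chain Q 2.
  have := esup_ub R_dim1 ch; by [].
exists chain; split.
  by case=> [|[|[|]]] // _; [apply: zero_prime | apply: max_prime].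
case=> [|[|]] // _; split.
- exact: zero_sub.
- by move=> /(_ x Px); rewrite in_zero_submod (negPf x0).
- by apply: proper_sub_max; case: Pprime.
- exact: mP.
Qed.

Lemma max_neq0 : exists2 x, x \in m & x != 0.
Proof.
have [[//|k] [P [Pprime /(_ 0%N isT)[_ nP]]] _] := esup_attained R_dim1.
apply: contrapT => m0; case: nP => x P1x.
suff -> : x = 0 by rewrite ideal0.
apply/eqP; apply: contrapT => /negP x0; apply: m0; exists x => //.
by apply: proper_sub_max P1x; have [] := Pprime 1%N isT.
Qed.

(** Devissage.  A non-zero proper ideal other than the maximal one is not
    prime, so it contains some product a b with a and b outside; then I + aR
    and (I : a) are both strictly larger than I.  It stands in for the
    filtration of R / I with quotients R / m. *)
Lemma nonzero_ideal_ind (P : submodClosed R^o -> Prop) :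
  (forall I, {subset m <= I} -> P I) ->
  (forall I a, P (sum_submod I (principal a)) -> P (colon I a) -> P I) ->
  forall I x, x \in I -> x != 0 -> P I.
Proof.
move=> Pm Pcolon I x; elim/(noetherian_ind R_noetherian): I => I IH Ix x0.
have [/Pm//|mI] := pselect {subset m <= I}.
have I1 : (1 : R) \notin I by apply/negP => I1; apply: mI => y _; apply: ideal1.
have nprime : ~ prime_ideal I by move=> /nonzero_prime_max/(_ Ix x0).
have [a [b [Iab Ia Ib]]] : exists a b : R, [/\ a * b \in I, a \notin I & b \notin I].
  apply: contrapT => noab; apply: nprime; split=> // a b Iab.
  apply: contrapT => /negP; rewrite negb_or => /andP[Ia Ib].
  by apply: noab; exists a, b.
apply: (Pcolon I a); apply: IH => //.
- exact: sub_suml.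
- move=> /(_ a); rewrite (negPf Ia) => H; suff : false by [].
  by apply: H; apply: sub_sumr; apply: mem_principal.
- exact: sub_suml.
- exact: sub_colon.
- move=> /(_ b); rewrite (negPf Ib) => H; suff : false by [].
  by apply: H; apply/colonP.
- exact: sub_colon.
Qed.

Lemma finite_colength I x : x \in I -> x != 0 -> finite_seg I (full_submod R^o).
Proof.
move: I x; refine (nonzero_ideal_ind (P := fun I => finite_seg I _) _ _);
  last by move=> I a; apply: finite_seg_colon.
move=> I mI.
(* Every proper ideal is contained in m, hence in I: the first strict step of
   a chain starting at I already reaches R. *)
suff s B n : seg I B n -> (n <= 1)%N /\ ((0 < n)%N -> (1 : R) \in B).
  by exists 1%N => n /s[].
elim=> // {}B C {}n sB [n1 nB] BC CB; have B1 : (1 : R) \notin B.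
  by apply/negP => B1; apply: CB => y _; apply: ideal1.
have n0 : n = 0%N by case: n n1 nB {sB} => // n _ /(_ isT); rewrite (negPf B1).
rewrite n0; split=> // _; apply: contrapT => /negP C1; apply: CB => y Cy.
by apply: (seg_sub sB); apply: mI; apply: proper_sub_max Cy.
Qed.

Lemma max_pow_sub I x : x \in I -> x != 0 ->
  exists k, {subset ideal_pow m k <= I}.
Proof.
move=> Ix x0.
suff [k kP] : exists k, forall a : 'I_k -> R,
    (forall j, a j \in m) -> \prod_j a j \in I.
  by exists k => y /asboolP; apply.
move: I x Ix x0; refine (nonzero_ideal_ind (P := fun I => exists k,
  forall a : 'I_k -> R, (forall j, a j \in m) -> \prod_j a j \in I) _ _).
  move=> I mI.
  exists 1%N => a am; rewrite big_ord_recl big_ord0 mulr1; exact: mI.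
move=> I a [k kP] [l lP].
exists (k + l)%N => c cm; rewrite big_split_ord /=.
have [i [r [Ii ->]]] := sum_principalP (kP _ (fun j => cm (lshift l j))).
have /colonP Iq := lP _ (fun j => cm (rshift k j)).
rewrite mulrDl; apply: idealD; first exact: idealMr.
by rewrite mulrAC; apply: idealMr.
Qed.

Lemma max_exp_dvd x b : x \in m -> b != 0 -> exists k c, x ^+ k = b * c.
Proof.
move=> mx b0; have [k kP] := max_pow_sub (mem_principal b) b0.
by exists k; apply/principalP/kP/exp_ideal_pow.
Qed.

End DimensionOne.

(** * A bound on the degrees of integral elements *)

Section IntegralElements.
Variable R : idomainType.
Local Notation K := {fraction R}.
Local Notation "r %:F" := (@tofrac R r).
Implicit Types (z : K) (q : {poly R}).

Lemma fraction_denominator z : exists a b : R, b != 0 /\ b%:F * z = a%:F.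
Proof.
elim/quotW: z => f; exists (frac f).1, (frac f).2; split.
  exact: denom_ratioP.
rewrite /GRing.mul /= !piE.
apply/eqP; rewrite eqmodE /= FracField.equivfE /FracField.mulf.
rewrite !numden_Ratio ?mulf_neq0 ?denom_ratioP ?oner_neq0 //.
by rewrite mulr1 !mul1r mulrC.
Qed.

Lemma integral_scale (a : R) z :
  integralOver (@tofrac R) z -> integralOver (@tofrac R) (a%:F * z).
Proof. by move=> Iz; exact: (integral_mul (integral_id (@tofrac R) a) Iz). Qed.

Definition polyval z q : K := (map_poly (@tofrac R) q).[z].

Lemma polyvalD z q q' : polyval z (q + q') = polyval z q + polyval z q'.
Proof. by rewrite /polyval rmorphD hornerD. Qed.

Lemma polyvalM z q q' : polyval z (q * q') = polyval z q * polyval z q'.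
Proof. by rewrite /polyval rmorphM hornerM. Qed.

Lemma polyvalC z c : polyval z c%:P = c%:F.
Proof. by rewrite /polyval map_polyC hornerC. Qed.

Lemma polyvalXn z n : polyval z 'X^n = z ^+ n.
Proof. by rewrite /polyval map_polyXn hornerXn. Qed.

Lemma polyval_denominator (y s : R) z d q :
  y%:F * z = s%:F -> (size q <= d.+1)%N ->
  exists r : R, (y ^+ d)%:F * polyval z q = r%:F.
Proof.
move=> yz qd; exists (\sum_(i < d.+1) q`_i * (y ^+ (d - i) * s ^+ i)).
rewrite /polyval (horner_coef_wide (n := d.+1)); last first.
  exact: leq_trans (size_poly _ _) qd.
rewrite mulr_sumr rmorph_sum; apply: eq_bigr => i _ /=.
rewrite coef_map /= !rmorphM /= !rmorphXn /= -yz exprMn.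
have {1}-> : y%:F ^+ d = y%:F ^+ (d - i) * y%:F ^+ i.
  by rewrite -exprD subnK // -ltnS.
by ring.
Qed.

(** A common denominator for the whole of R[z]: modulo a monic equation of z
    all polynomials in z have bounded degree. *)
Lemma integral_denominator (y s : R) z :
  integralOver (@tofrac R) z -> y%:F * z = s%:F ->
  exists d, forall q, exists r : R, (y ^+ d)%:F * polyval z q = r%:F.
Proof.
move=> [p p_monic /rootP pz] yz; exists (size p) => q.
rewrite (Pdiv.RingMonic.rdivp_eq p_monic q) polyvalD polyvalM.
rewrite [polyval z p]pz mulr0 add0r; apply: polyval_denominator yz _.
by apply/leqW/ltnW; rewrite Pdiv.Ring.ltn_rmodp monic_neq0.
Qed.

End IntegralElements.

Section DegreeBound.
Variables (R : idomainType) (x : R) (z : {fraction R}) (k N : nat) (s : R).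
Local Notation K := {fraction R}.
Local Notation "r %:F" := (@tofrac R r).
Hypothesis x0 : x != 0.
Hypothesis fin : forall (I : submodClosed R^o) (u : R), u \in I -> u != 0 ->
  finite_seg I (full_submod R^o).
Hypothesis N_bound : forall n,
  seg (principal x) (full_submod R^o) n -> (n <= N.+1)%N.
Hypothesis z_int : integralOver (@tofrac R) z.
Hypothesis xkz : (x ^+ k)%:F * z = s%:F.
Local Notation ev := (polyval z).

Lemma denominator_exp :
  exists e, forall q, exists r : R, (x ^+ e)%:F * ev q = r%:F.
Proof.
have [d dP] := integral_denominator z_int xkz.
by exists (k * d)%N => q; rewrite exprM.
Qed.

(** The quotient R[z] / x R[z] has length at most N + 1, because R[z] has rank
    one: multiplied by a denominator x^e it becomes an ideal I, and I / xI is
    no longer than R / xR.  So the chain W_j spanned modulo x R[z] by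
    1, ..., z^(j-1) cannot increase strictly N + 2 times. *)
Lemma power_mod_x : exists q q' : {poly R},
  (size q' <= N.+1)%N /\ z ^+ N.+1 = x%:F * ev q + ev q'.
Proof.
have [e eP] := denominator_exp.
have xe0 : (x ^+ e)%:F != 0 by rewrite tofrac_eq0 expf_neq0.
have Iprop : submod_prop (V := R^o)
    (fun r => exists q, (r : R)%:F = (x ^+ e)%:F * ev q).
  split; first by exists 0; rewrite /polyval !rmorph0 horner0 mulr0.
  move=> a r r' [q qE] [q' q'E]; exists (a%:P * q + q').
  by rewrite rmorphD rmorphM /= qE q'E polyvalD polyvalM polyvalC; ring.
have Wprop j : submod_prop (V := R^o) (fun r => exists q q' : {poly R},
    (size q' <= j)%N /\ (r : R)%:F = (x ^+ e)%:F * (x%:F * ev q + ev q')).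
  split.
    exists 0, 0; rewrite size_poly0 /polyval !rmorph0 horner0.
    by rewrite !mulr0 addr0 mulr0.
  move=> a r r' [q [q' [sq' qE]]] [p [p' [sp' pE]]].
  exists (a%:P * q + p), (a%:P * q' + p'); split.
    rewrite (leq_trans (size_polyD _ _)) // geq_max sp' andbT.
    by rewrite mul_polyC (leq_trans (size_scale_leq _ _)).
  by rewrite rmorphD rmorphM /= qE pE !polyvalD !polyvalM !polyvalC; ring.
pose I : submodClosed R^o := submod_of Iprop.
pose W j : submodClosed R^o := submod_of (Wprop j).
have WI j : {subset W j <= I}.
  move=> r /(submod_ofP (Wprop j))[q [q' [_ rE]]]; apply/(submod_ofP Iprop).
  by exists (x%:P * q + q'); rewrite rE polyvalD polyvalM polyvalC.
have WS j : {subset W j <= W j.+1}.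
  move=> r /(submod_ofP (Wprop j))[q [q' [sq' rE]]].
  by apply/(submod_ofP (Wprop j.+1)); exists q, q'; rewrite ltnW.
have [j [jN Wj]] : exists j, (j <= N.+1)%N /\ {subset W j.+1 <= W j}.
  apply: contrapT => noj.
  have sW j : (j <= N.+2)%N -> seg (W 0%N) (W j) j.
    elim: j => [_|j IHj jN]; first exact: seg_nil.
    apply: seg_step (IHj (ltnW jN)) (WS j) _ => Wj.
    by apply: noj; exists j.
  have xI : {subset frac_mul x 1 I <= I}.
    move=> v /frac_mulP[u Iu]; rewrite mul1r => ->; exact: idealMl.
  have Ixe : x ^+ e \in I.
    by apply/(submod_ofP Iprop); exists 1; rewrite polyvalC mulr1.
  have sxI : seg (frac_mul x 1 I) I N.+2.
    apply: seg_widenl (seg_widenr (sW _ (leqnn _)) (WI _)) _.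
    move=> v /frac_mulP[u /(submod_ofP Iprop)[q qE]]; rewrite mul1r => ->.
    apply/(submod_ofP (Wprop 0%N)); exists q, 0; rewrite size_poly0; split=> //.
    by rewrite rmorphM /= qE /polyval rmorph0 horner0 addr0; ring.
  have := @frac_mul_colength _ x 1 I (full_submod R^o) N.+2 0 x0 (oner_neq0 _)
    (@sub_full _ _ _) _ (fin Ixe (expf_neq0 _ x0)) sxI (seg_nil (fun=> id)).
  move=> /(_ _)/seg_widenl H.
  suff : (N.+2 + 0 <= N.+1)%N by rewrite addn0 ltnn.
  apply: N_bound; apply: H => [u _|_ /principalP[c ->]].
    by exists (x * u); rewrite mul1r.
  by apply/frac_mulP; exists c; rewrite ?mul1r ?in_full.
have [r rE] := eP 'X^j.
have : r \in W j.+1.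
  apply/(submod_ofP (Wprop j.+1)); exists 0, 'X^j; rewrite size_polyXn.
  by rewrite -rE /polyval rmorph0 horner0 mulr0 add0r.
move=> /Wj/(submod_ofP (Wprop j))[q [q' [sq' ]]]; rewrite -rE => /(mulfI xe0).
rewrite polyvalXn => zj; exists (q * 'X^(N.+1 - j)), (q' * 'X^(N.+1 - j)); split.
  rewrite (leq_trans (size_polyMleq _ _)) // size_polyXn addnS /=.
  by rewrite -[leqRHS](subnKC jN) leq_add2r.
by rewrite !polyvalM !polyvalXn -[in LHS](subnKC jN) exprD zj; ring.
Qed.

Lemma poly_mod_x q : exists q1 q2 : {poly R},
  (size q2 <= N.+1)%N /\ ev q = x%:F * ev q1 + ev q2.
Proof.
have [p [p' [sp' zN]]] := power_mod_x.
elim/poly_ind: q => [|q c [q1 [q2 [sq2 qE]]]].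
  by exists 0, 0; rewrite size_poly0 /polyval rmorph0 horner0 mulr0 addr0.
pose t := q2`_N; pose u := q2 * 'X + c%:P - t%:P * 'X^(N.+1).
have su : (size u <= N.+1)%N.
  apply/leq_sizeP => j; rewrite leq_eqVlt => /predU1P[<-|jN].
    rewrite !coefD coefN coefMX coefC coefCM coefXn /= eqxx mulr1 addr0.
    by rewrite subrr.
  rewrite !coefD coefN coefMX coefC coefCM coefXn.
  case: j jN => // j jN; rewrite /= gtn_eqF // mulr0 subr0 addr0.
  by rewrite nth_default // (leq_trans sq2).
exists (q1 * 'X + t%:P * p), (u + t%:P * p'); split.
  rewrite (leq_trans (size_polyD _ _)) // geq_max su.
  by rewrite mul_polyC (leq_trans (size_scale_leq _ _)).
have -> : q * 'X + c%:P = q * 'X - q2 * 'X + u + t%:P * 'X^(N.+1).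
  by rewrite /u; ring.
have evN a : ev (- a) = - ev a by rewrite /polyval rmorphN hornerN.
have evX : ev 'X = z by rewrite -['X]expr1 polyvalXn expr1.
rewrite !polyvalD evN !polyvalM !polyvalC polyvalXn zN qE evX; ring.
Qed.

Lemma poly_mod_exp n q : exists q1 q2 : {poly R},
  (size q2 <= N.+1)%N /\ ev q = (x ^+ n)%:F * ev q1 + ev q2.
Proof.
elim: n => [|n [q1 [q2 [sq2 ->]]]].
  by exists q, 0; rewrite size_poly0 /polyval rmorph0 horner0 expr0 rmorph1 mul1r addr0.
have [p1 [p2 [sp2 ->]]] := poly_mod_x q1.
exists p1, ((x ^+ n)%:P * p2 + q2); split.
  rewrite (leq_trans (size_polyD _ _)) // geq_max sq2 andbT.
  by rewrite mul_polyC (leq_trans (size_scale_leq _ _)).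
by rewrite polyvalD polyvalM polyvalC exprSr rmorphM /=; ring.
Qed.

(** For n a denominator exponent of R[z], the term x^n R[z] of [poly_mod_exp]
    falls into R, so R[z] is generated by 1, ..., z^N.  Multiplying the
    expression of z^(N+1) by x^(k (N+1)) leaves one spare factor x^k. *)
Lemma integral_exp_dvd : exists c, s ^+ N.+1 = x ^+ k * c.
Proof.
have [e eP] := denominator_exp.
have [q1 [q2 [sq2 zE]]] := poly_mod_exp e 'X^(N.+1).
have [r rE] := eP q1.
have {}zE : z ^+ N.+1 = ev (r%:P + q2).
  by rewrite -polyvalXn zE polyvalD polyvalC rE.
have [|c cE] := polyval_denominator (d := N) (q := r%:P + q2) xkz.
  rewrite (leq_trans (size_polyD _ _)) // geq_max sq2 andbT.
  by rewrite (leq_trans (size_polyC_leq1 _)).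
exists c; apply/eqP; rewrite -tofrac_eq; apply/eqP.
by rewrite rmorphXn /= -xkz exprMn zE rmorphM /= -cE mulrA -rmorphXn -rmorphM exprS.
Qed.

End DegreeBound.

(** * Nilpotent limits in the completion *)

Section CompletionNilpotent.
Variables (R : comPzRingType) (I : submodClosed R^o).

Lemma quotmod_piX (L : submodClosed R^o) (r : R) n :
  (\pi_(quotmod L) (r : R^o)) ^+ n = \pi_(quotmod L) (r ^+ n : R^o).
Proof.
elim: n => [|n IH]; first by rewrite !expr0.
by rewrite !exprS IH; apply: quotmod_mulE.
Qed.

(** The sequence s converges to an element of the completion whose N-th power
    vanishes; when the completion is reduced, so does every component of the
    limit. *)
Lemma reduced_completion_lim (s : nat -> R) N :
  reduced (completion I) ->
  (forall k, s k.+1 - s k \in ideal_pow I k) ->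
  (forall k, s k ^+ N \in ideal_pow I k) ->
  forall k, s k \in ideal_pow I k.
Proof.
move=> red sC sN.
pose u : prodring (fun n => quotmod (ideal_pow I n)) :=
  fun n => \pi_(quotmod (ideal_pow I n)) (s n : R^o).
have uC : u \in @adic_compatible R I.
  by apply/asboolP => n; apply: etrans (adic_projE _ _ _) _; apply/quotmodP.
pose U : completion I := exist _ u uC.
have UN : U ^+ N = 0.
  apply: val_inj; rewrite rmorphXn /=.
  apply: functional_extensionality_dep => k.
  have -> n : (u ^+ n) k = (u k) ^+ n.
    by elim: n => [|n IH]; rewrite ?expr0 // !exprS -IH.
  by rewrite quotmod_piX; apply/quotmod_pi_eq0.
have /(congr1 val) U0 := red U N UN.
move=> k; apply/quotmod_pi_eq0.
exact: (congr1 (fun f : prodring _ => f k) U0).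
Qed.

End CompletionNilpotent.

(** * The conductor is not zero *)

Section ConductorNonzero.
Variables (R : idomainType) (m : submodClosed R^o).
Hypothesis R_noetherian : noetherian_ring R.
Hypothesis R_local : local_ring m.
Hypothesis R_dim1 : krull_dim R = Some 1%N.
Hypothesis R_hat_reduced : reduced (completion m).
Local Notation K := {fraction R}.
Local Notation "r %:F" := (@tofrac R r).

Variable x : R.
Hypothesis mx : x \in m.
Hypothesis x0 : x != 0.

Lemma closure_power_submod_prop n : submod_prop (V := R^o) (fun r : R =>
  exists2 z, integralOver (@tofrac R) z & r%:F = (x ^+ n)%:F * z).
Proof.
split; first by exists 0; [rewrite -(rmorph0 (@tofrac R)); exact: (integral_id (@tofrac R) 0)
                          | rewrite rmorph0 mulr0].
move=> a r r' [z Iz rE] [z' Iz' r'E]; exists (a%:F * z + z').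
  exact: (integral_add (integral_scale a Iz) Iz').
by rewrite rmorphD rmorphM /= rE r'E; ring.
Qed.

(** The intersection of R with x^n Rbar, which is the integral closure of the
    ideal x^n R. *)
Definition closure_power n : submodClosed R^o :=
  submod_of (closure_power_submod_prop n).

Lemma closure_powerP n (r : R) :
  reflect (exists2 z, integralOver (@tofrac R) z & r%:F = (x ^+ n)%:F * z)
          (r \in closure_power n).
Proof. exact: (submod_ofP (closure_power_submod_prop n)). Qed.

Lemma closure_power_dec i j : (i <= j)%N ->
  {subset closure_power j <= closure_power i}.
Proof.
move=> ij r /closure_powerP[z Iz rE]; apply/closure_powerP.
exists ((x ^+ (j - i))%:F * z).
  exact: integral_scale.
by rewrite mulrA -rmorphM -exprD subnKC.
Qed.

Lemma principal_closure_power n :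
  {subset principal (x ^+ n) <= closure_power n}.
Proof.
move=> _ /principalP[c ->]; apply/closure_powerP; exists c%:F.
  exact: (integral_id (@tofrac R) c).
by rewrite rmorphM.
Qed.

Let fin (I : submodClosed R^o) (u : R) : u \in I -> u != 0 ->
  finite_seg I (full_submod R^o).
Proof. exact: (finite_colength R_noetherian R_local R_dim1). Qed.

Lemma closure_power_exp : exists N, forall n s,
  s \in closure_power n -> s ^+ N \in principal (x ^+ n).
Proof.
have [N Nmax] := fin (mem_principal x) x0.
exists N.+1 => n s /closure_powerP[z Iz sE].
apply/principalP; apply: (integral_exp_dvd x0 fin _ Iz (esym sE)) => k /Nmax.
exact: leqW.
Qed.

Definition closure_power_mod k n : submodClosed R^o :=
  sum_submod (closure_power n) (principal (x ^+ k.+1)).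

Lemma closure_power_stable k :
  exists n0, forall n, {subset closure_power n0 <= closure_power_mod k n}.
Proof.
have xk0 : x ^+ k.+1 != 0 by rewrite expf_neq0.
have [||n0 n0P] := finite_seg_dcc (D := closure_power_mod k)
    (fin (mem_principal (x ^+ k.+1)) xk0).
- by move=> n; split; [apply: sub_sumr | apply: sub_full].
- move=> i j ij; apply: sum_sub; last exact: sub_sumr.
  by move=> r /(closure_power_dec ij); apply: sub_suml.
by exists n0 => n r rT; apply: n0P; apply: sub_suml.
Qed.

(** If this fails, elements s_k of [closure_power k] outside xR are built so
    as to converge.  The ideals L_k of the elements congruent to one of
    [closure_power n] modulo x^(k+1) for every n make the choices possible:
    by stability L_k contains a whole [closure_power n], so an element of L_k
    is congruent modulo x^(k+1) to an element of L_(k+1). *)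
Lemma closure_power_sub_principal :
  exists n, {subset closure_power n <= principal x}.
Proof.
apply: contrapT => noN.
pose L k r := forall n, r \in closure_power_mod k n.
have step (kr : nat * R) : exists r' : R, L kr.1 kr.2 ->
    L kr.1.+1 r' /\ r' - kr.2 \in principal (x ^+ kr.1.+1).
  case: kr => k r /=.
  have [Lr|nLr] := pselect (L k r); last by exists 0.
  have [n0 n0P] := closure_power_stable k.+1.
  have [t [c [Tt rE]]] := sum_principalP (Lr n0).
  exists t => _; split; first by move=> n; apply: n0P.
  by apply/principalP; exists (- c); rewrite rE; ring.
have [F FP] := choice step.
have [s0 [Ls0 s0x]] : exists s0 : R, L 0%N s0 /\ s0 \notin principal x.
  have [n0 n0P] := closure_power_stable 0%N.
  apply: contrapT => nos; apply: noN; exists n0 => r Tr.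
  apply: contrapT => /negP rx; apply: nos; exists r; split=> // n.
  exact: n0P.
pose fix s k := if k is k'.+1 then F (k', s k') else s0.
have Ls k : L k (s k) by elim: k => // k IH; have [] := FP (k, s k) IH.
have sS k : s k.+1 - s k \in principal (x ^+ k.+1).
  by have [] := FP (k, s k) (Ls k).
have sx k : s k \notin principal x.
  elim: k => // k; apply: contraNN => sx.
  have -> : s k = s k.+1 - (s k.+1 - s k) by ring.
  apply: idealB => //; rewrite -[x]expr1.
  exact: principal_expS (sS k).
have sT k : s k \in closure_power k.
  apply: (sum_sub (A := closure_power k) _ _ (Ls k k)) => //.
  move=> r /(principal_expS (leqnSn k)); exact: principal_closure_power.
have xpow k : {subset principal (x ^+ k) <= ideal_pow m k}.
  exact/sub_principal/exp_ideal_pow.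
have [N NP] := closure_power_exp.
have [k kP] := max_pow_sub R_noetherian R_local R_dim1 (mem_principal x) x0.
have /negP := sx k; apply; apply: kP.
apply: (reduced_completion_lim (N := N) R_hat_reduced) => [j|j].
  apply: xpow; exact: principal_expS (sS j).
by apply: xpow; apply: NP.
Qed.

Lemma exp_in_conductor : exists n, x ^+ n \in conductor R.
Proof.
have [n nP] := closure_power_sub_principal.
exists n; apply/asboolP => z Iz.
have exk : exists k, `[< exists r : R, (x ^+ k)%:F * z = r%:F >].
  have [a [b [b0 bz]]] := fraction_denominator z.
  have [k [c xk]] := max_exp_dvd R_noetherian R_local R_dim1 mx b0.
  exists k; apply/asboolP; exists (c * a).
  by rewrite xk [b * c]mulrC !rmorphM /= -mulrA bz.
case: (ex_minnP exk) => k /asboolP[r rE] kmin.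
have [kn|nk] := leqP k n.
  exists (x ^+ (n - k) * r).
  by rewrite rmorphM /= -rE mulrA -rmorphM -exprD subnK.
case: k nk rE kmin => // k nk rE kmin.
have /nP/principalP[c rc] : r \in closure_power n.
  apply/closure_powerP; exists ((x ^+ (k.+1 - n))%:F * z).
    exact: integral_scale.
  by rewrite mulrA -rmorphM -exprD subnKC ?(ltnW nk).
suff /kmin : `[< exists r : R, (x ^+ k)%:F * z = r%:F >] by rewrite ltnn.
apply/asboolP; exists c.
have xF0 : x%:F != 0 by rewrite tofrac_eq0.
by apply: (mulfI xF0); rewrite mulrA -rmorphM -exprS rE rc rmorphM.
Qed.

End ConductorNonzero.

Lemma conductor_neq0 (R : idomainType) (m : submodClosed R^o) :
  noetherian_ring R -> local_ring m -> krull_dim R = Some 1%N ->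
  reduced (completion m) -> exists2 c : R, c \in conductor R & c != 0.
Proof.
move=> R_noetherian R_local R_dim1 R_hat_reduced.
have [x mx x0] := max_neq0 R_noetherian R_local R_dim1.
have [n xn] := exp_in_conductor R_noetherian R_local R_dim1 R_hat_reduced mx x0.
by exists (x ^+ n); rewrite ?expf_neq0.
Qed.

(** * Homomorphisms from ideals containing the conductor *)

Section ConductorLinear.
Variables (R : idomainType) (J : submodClosed R^o).
Local Notation K := {fraction R}.
Local Notation "r %:F" := (@tofrac R r).
Local Notation C := (conductor R : submodClosed R^o).
Hypothesis CJ : {subset C <= J}.
Variable phi : {linear submodule J -> R^o}.

Let elt u (Ju : u \in J) : submodule J := exist _ u Ju.

(** Both sides are the value of phi at u v; hence phi is multiplication by the
    fraction phi(u) / u, for any non-zero u in J. *)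
Lemma linear_ideal_swap u v (Ju : u \in J) (Jv : v \in J) :
  (u : R) * phi (elt Jv) = (v : R) * phi (elt Ju).
Proof.
have E : u *: elt Jv = v *: elt Ju by apply: val_inj; apply: mulrC.
by have := congr1 phi E; rewrite !linearZ.
Qed.

(** The conductor is an ideal of the integral closure as well. *)
Lemma conductor_integral (r : R) z :
  r \in C -> integralOver (@tofrac R) z ->
  exists2 r' : R, r' \in C & r%:F * z = r'%:F.
Proof.
move=> /asboolP Cr Iz; have [r' rz] := Cr z Iz.
exists r' => //; apply/asboolP => w Iw; rewrite -rz -mulrA.
exact: Cr (integral_mul Iz Iw).
Qed.

(** The image of C under phi is stable under multiplication by integral
    elements, since phi (u) z = phi (u z), and it lies in R. *)
Lemma frac_mul_conductor (c : R) (Cc : c \in C) : c != 0 ->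
  {subset frac_mul (phi (elt (CJ Cc))) c C <= C}.
Proof.
move=> c0 v /frac_mulP[u Cu vu]; apply/asboolP => z Iz.
have [r Cr uz] := conductor_integral Cu Iz.
pose a : R := phi (elt (CJ Cc)); pose b : R := phi (elt (CJ Cr)).
have cb : c * b = r * a := linear_ideal_swap (CJ Cc) (CJ Cr).
have cv : c * v = a * u := vu.
exists b; have cF0 : c%:F != 0 by rewrite tofrac_eq0.
apply: (mulfI cF0); rewrite -rmorphM cb mulrA -rmorphM cv !rmorphM /= -uz.
by ring.
Qed.

Lemma conductor_image_colength c n :
  c \in C -> c != 0 -> finite_seg C (full_submod R^o) ->
  seg J (full_submod R^o) n -> seg (linear_image phi) (full_submod R^o) n.
Proof.
move=> Cc c0 Cfin sJ; pose a : R := phi (elt (CJ Cc)).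
have imP (v : R) : v \in linear_image phi -> exists2 u : R, u \in J & c * v = a * u.
  move=> /asboolP[[u Ju] <-]; exists u => //.
  by rewrite [RHS]mulrC; exact: (linear_ideal_swap (CJ Cc) Ju).
(* If a = 0 then phi = 0, and R / 0 is at least as long as R / J. *)
have [a0|a0] := eqVneq a 0.
  apply: seg_widenl sJ _ => v /imP[u _]; rewrite a0 mul0r => /eqP.
  by rewrite mulf_eq0 (negPf c0) => /eqP->; apply: ideal0.
have Jab u : u \in J -> exists v : R, c * v = a * u.
  move=> Ju; exists (phi (elt Ju)).
  by rewrite (linear_ideal_swap (CJ Cc) Ju) mulrC.
have CJfin : finite_seg C J := finite_segS (fun=> id) (@sub_full _ _ J) Cfin.
have sC : seg (frac_mul a c C) C 0 by apply: seg_nil; apply: frac_mul_conductor.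
have := frac_mul_colength a0 c0 CJ Jab CJfin sC sJ.
by move=> /seg_widenl; apply=> v /imP vP; apply/frac_mulP.
Qed.

End ConductorLinear.

Theorem corollary2p6 (R : idomainType) (m : submodClosed R^o)
    (R_noetherian : noetherian_ring R)
    (R_local : local_ring m)
    (R_dim1 : krull_dim R = Some 1%N)
    (R_hat_reduced : reduced (completion m)) :
  (forall J : submodClosed R^o, {subset conductor R <= J} ->
     h (submodule J) = length (quotmod J)) /\
  h (submodule (conductor R)) = length (quotmod (conductor R)).
Proof.
suff main (J : submodClosed R^o) : {subset conductor R <= J} ->
    h (submodule J) = length (quotmod J) by split=> //; apply: main.
move=> CJ.
have [c Cc c0] := conductor_neq0 R_noetherian R_local R_dim1 R_hat_reduced.
have Cfin := finite_colength R_noetherian R_local R_dim1 Cc c0.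
apply: emin_eq => [|n [phi _]].
  pose inc : {linear submodule J -> R^o} := \val.
  exists inc => //; rewrite !length_quotmod; congr esup.
  apply/funext => n; apply/propext.
  have incE : linear_image inc =i J.
    move=> v; apply/asboolP/idP => [[u <-]|Jv]; first exact: valP.
    by exists (exist _ v Jv).
  by split=> s; apply: seg_widenl s _ => v; rewrite incE.
rewrite !length_quotmod; apply: esup_mono => k sJ.
exact: conductor_image_colength CJ phi c k Cc c0 Cfin sJ.
Qed.
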